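(* Let $G_1$ and $G_2$ be two connected graphs, each with $n$ vertices and $m$ edges, having Laplacian spectra $0=\mu_n<\mu_{n-1}\leq\cdots\leq\mu_1$ and $0=\lambda_n<\lambda_{n-1}\leq\cdots\leq\lambda_1$, respectively. Let $p\geq 2n$ be a positive integer such that $$\frac{2m}{p+n}<\min(\mu_{n-1},\lambda_{n-1}).$$ Then $LE(\tilde{G_1})=LE(\tilde{G_2})$, where $\tilde{G_i}=(\overline{G_i}\cup K_p)\times K_p$ for $i=1,2$.
   Context: All graphs are finite, undirected and simple. For a graph $G$ with $N$ vertices and $M$ edges, adjacency matrix $A(G)$ and diagonal degree matrix $D(G)$, the Laplacian matrix is $L(G)=D(G)-A(G)$; its eigenvalues with multiplicity, $\mu_1,\dots,\mu_N$, form the Laplacian spectrum of $G$. The Laplacian energy is $LE(G)=\sum_{i=1}^{N}\left|\mu_i-\frac{2M}{N}\right|$. $\overline{G}$ is the complement of $G$, $K_p$ the complete graph on $p$ vertices, and $G\cup H$ the disjoint union. $G\times H$ is the Cartesian product: vertex set $V(G)\times V(H)$, with $(u_1,v_1)$ adjacent to $(u_2,v_2)$ iff either $u_1=u_2$ and $v_1v_2\in E(H)$, or $v_1=v_2$ and $u_1u_2\in E(G)$. Writing $\mu_{n-1}$ presupposes $n\ge 2$. *)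

(* Defs.v *)
From mathcomp Require Import all_boot all_order all_algebra.
From mathcomp Require Import complex.

Set Implicit Arguments.
Unset Strict Implicit.
Unset Printing Implicit Defensive.

Import Order.TTheory GRing.Theory Num.Theory.

Record sgraph := SGraph {
  vertex :> finType;
  adj : rel vertex;
  adj_sym : symmetric adj;
  adj_irr : irreflexive adj
}.

Section Operations.

Variables G H : sgraph.

Definition compl_rel : rel G := fun x y => (x != y) && ~~ adj x y.

Lemma compl_sym : symmetric compl_rel.
Proof. by move=> x y; rewrite /compl_rel eq_sym adj_sym. Qed.

Lemma compl_irr : irreflexive compl_rel.
Proof. by move=> x; rewrite /compl_rel eqxx. Qed.

Definition compl : sgraph := SGraph compl_sym compl_irr.

Definition union_rel : rel (G + H) := fun u v =>
  match u, v with
  | inl x, inl y => adj x y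
  | inr x, inr y => adj x y
  | _, _ => false
  end.

Lemma union_sym : symmetric union_rel.
Proof. by move=> [x|x] [y|y] //=; rewrite adj_sym. Qed.

Lemma union_irr : irreflexive union_rel.
Proof. by move=> [x|x] /=; rewrite adj_irr. Qed.

Definition disjoint_union : sgraph := SGraph union_sym union_irr.

Definition cartesian_rel : rel (G * H) := fun u v =>
  ((u.1 == v.1) && adj u.2 v.2) || ((u.2 == v.2) && adj u.1 v.1).

Lemma cartesian_sym : symmetric cartesian_rel.
Proof.
move=> u v; rewrite /cartesian_rel (adj_sym u.2) (adj_sym u.1).
by rewrite (eq_sym u.1) (eq_sym u.2).
Qed.

Lemma cartesian_irr : irreflexive cartesian_rel.
Proof. by move=> u; rewrite /cartesian_rel !adj_irr !andbF. Qed.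

Definition cartesian : sgraph := SGraph cartesian_sym cartesian_irr.

End Operations.

Section Complete.

Variable p : nat.

Definition complete_rel : rel 'I_p := fun i j => i != j.

Lemma complete_sym : symmetric complete_rel.
Proof. by move=> i j; rewrite /complete_rel eq_sym. Qed.

Lemma complete_irr : irreflexive complete_rel.
Proof. by move=> i; rewrite /complete_rel eqxx. Qed.

Definition complete : sgraph := SGraph complete_sym complete_irr.

End Complete.

Definition connected (G : sgraph) : Prop :=
  0 < #|G| /\ forall x y : G, connect (@adj G) x y.

Definition edges (G : sgraph) : {set {set G}} :=
  [set e : {set G} | [exists x, exists y, adj x y && (e == [set x; y])]].

Definition degree (G : sgraph) (x : G) : nat := #|[set y | adj x y]|.

Local Open Scope ring_scope.

Section SymmetricSpectrum.

Local Open Scope complex_scope.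

Lemma char_poly_conj (F : fieldType) n (P D : 'M[F]_n) :
  P \in unitmx -> char_poly (invmx P *m D *m P) = char_poly D.
Proof.
move=> Pu; rewrite /char_poly.
have -> : char_poly_mx (invmx P *m D *m P) =
    map_mx polyC (invmx P) *m char_poly_mx D *m map_mx polyC P.
  rewrite /char_poly_mx mulmxBr mulmxBl scalar_mxC -(mulmxA _ _ (map_mx _ P)) -!map_mxM /=.
  by rewrite mulVmx // map_mx1 mulmx1.
rewrite !det_mulmx mulrAC -det_mulmx -map_mxM mulVmx //.
by rewrite map_mx1 det1 mul1r.
Qed.

Lemma symmetric_char_poly_splits (R : rcfType) n (A : 'M[R]_n) :
  A^T = A -> exists s : seq R, char_poly A == \prod_(x <- s) ('X - x%:P).
Proof.
move=> Asym; pose B : 'M[R[i]]_n := map_mx (real_complex R) A.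
have Bherm : B \is hermsymmx.
  apply: realsym_hermsym.
    apply/is_hermitianmxP; rewrite expr0 scale1r map_mx_id //.
    by apply/matrixP => i j; rewrite !mxE -[in LHS]Asym mxE.
  by apply/mxOverP => i j; rewrite mxE; apply/complex_realP; exists (A i j).
have /orthomx_spectralP defB := hermitian_normalmx Bherm.
have dreal := mxOverP (hermitian_spectral_diag_real Bherm).
exists [seq complex.Re (spectral_diag B 0 i) | i <- enum 'I_n].
apply/eqP/(map_poly_inj (real_complex R)).
rewrite map_char_poly -/B [in LHS]defB char_poly_conj ?spectral_unit //.
rewrite char_poly_trig ?diag_mx_is_trig // big_map big_enum /= rmorph_prod.
apply: eq_bigr => i _; rewrite rmorphB /= map_polyX map_polyC /= mxE eqxx.
by rewrite mulr1n RRe_real.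
Qed.

End SymmetricSpectrum.

Section Laplacian.

Variables (R : rcfType) (G : sgraph).

Definition adjacency_matrix : 'M[R]_#|G| :=
  \matrix_(i, j) (adj (enum_val i) (enum_val j))%:R.

Definition degree_matrix : 'M[R]_#|G| :=
  diag_mx (\row_i (degree (enum_val i))%:R).

Definition laplacian : 'M[R]_#|G| := degree_matrix - adjacency_matrix.

Lemma laplacian_splits :
  exists s : seq R, char_poly laplacian == \prod_(x <- s) ('X - x%:P).
Proof.
apply: symmetric_char_poly_splits; rewrite /laplacian linearB /= tr_diag_mx.
by congr (_ - _); apply/matrixP => i j; rewrite !mxE adj_sym.
Qed.

(* Eigenvalues in non-increasing order, repeated according to their
   multiplicity as roots of the characteristic polynomial; the entry of index
   k is the (k+1)-st largest eigenvalue. *)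
Definition laplacian_spectrum : seq R := sort >=%R (xchoose laplacian_splits).

Definition laplacian_energy : R :=
  \sum_(mu <- laplacian_spectrum) `|mu - (2 * #|edges G|)%:R / #|G|%:R|.

End Laplacian.

(* Main.v *)
(* Tensor products of eigenvectors diagonalize the Laplacian of a Cartesian
   product, and when 0 is a simple eigenvalue of L(G), the eigenvectors of L(G)
   diagonalize that of the complement, sending each nonzero eigenvalue mu_i to
   n - mu_i.  The spectrum of the constructed graph thus consists of a part
   depending on p only and of the sums n - mu_i + kappa_j, with kappa_j in {0, p}
   an eigenvalue of K_p.  For n >= 3 the bound on mu_i puts all of these below
   the mean, so their contribution to the energy depends on the mu_i only through
   their sum 2m; for n = 2 the single mu_i equals 2m. *)
Require Import Defs.
From mathcomp Require Import all_boot all_order all_algebra.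
From mathcomp Require Import complex ring lra zify.

Set Implicit Arguments.
Unset Strict Implicit.
Unset Printing Implicit Defensive.

Import Order.TTheory GRing.Theory Num.Theory.
Local Open Scope ring_scope.

(** * Diagonalization by a pair of inverse matrices indexed by finite types *)

Section Eigenbasis.

Variables (F : fieldType) (T I : finType).
Implicit Types (M : T -> T -> F) (d : I -> F) (P : I -> T -> F) (Q : T -> I -> F).

(* The rows of [P] are left eigenvectors of [M] and [Q] is the inverse of [P]. *)
Definition eigenbasis M d P Q : Prop :=
  [/\ forall i j, \sum_x P i x * Q x j = (i == j)%:R,
      forall x y, \sum_i Q x i * P i y = (x == y)%:R
    & forall i y, \sum_x P i x * M x y = d i * P i y].

Lemma sum_delta (U : finType) (f : U -> F) y : \sum_x f x * (x == y)%:R = f y.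
Proof.
rewrite (bigD1 y) //= eqxx mulr1 big1 ?addr0 // => x /negPf ->.
by rewrite mulr0.
Qed.

Lemma sum_deltal (U : finType) (f : U -> F) y : \sum_x (y == x)%:R * f x = f y.
Proof.
by rewrite -[RHS]sum_delta; apply: eq_bigr => x _; rewrite mulrC eq_sym.
Qed.

(** With [P], [Q] and [M] read as matrices, [M = QPM = Q diag(d) P]. *)
Lemma eigenbasis_expand M d P Q x y : eigenbasis M d P Q ->
  M x y = \sum_i Q x i * (d i * P i y).
Proof.
case=> _ QP PM; under eq_bigr do rewrite -PM mulr_sumr.
rewrite exchange_big /=.
under eq_bigr do (under eq_bigr do rewrite mulrA).
rewrite -[LHS](sum_deltal (M^~ y)).
by apply: eq_bigr => z _; rewrite -mulr_suml QP.
Qed.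

(** A product of matrices equal to the identity cannot have more rows than its inner dimension;
    [PQ = 1] and [QP = 1] give the two inequalities. *)
Lemma eigenbasis_card M d P Q : eigenbasis M d P Q -> #|I| = #|T|.
Proof.
case=> PQ QP _.
pose A : 'M[F]_(#|I|, #|T|) := \matrix_(i, x) P (enum_val i) (enum_val x).
pose B : 'M[F]_(#|T|, #|I|) := \matrix_(x, i) Q (enum_val x) (enum_val i).
apply/eqP; rewrite eqn_leq; apply/andP; split.
  apply: (@mulmx1_min _ _ _ A B); apply/matrixP => i j; rewrite !mxE.
  under eq_bigr do rewrite !mxE.
  rewrite -(big_enum_val (fun x => P (enum_val i) x * Q x (enum_val j))) PQ.
  by rewrite (inj_eq enum_val_inj).
apply: (@mulmx1_min _ _ _ B A); apply/matrixP => i j; rewrite !mxE.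
under eq_bigr do rewrite !mxE.
rewrite -(big_enum_val (fun x => Q (enum_val i) x * P x (enum_val j))) QP.
by rewrite (inj_eq enum_val_inj).
Qed.

Lemma eigenbasis_char_poly M d P Q : eigenbasis M d P Q ->
  char_poly (\matrix_(k < #|T|, l < #|T|) M (enum_val k) (enum_val l)) =
  \prod_i ('X - (d i)%:P).
Proof.
move=> ebM; have eIT := eigenbasis_card ebM; case: (ebM) => PQ QP PM.
(* Enumerating [I] by the ordinals below [#|T|] turns [P] and [Q] into square matrices, so that the
   matrix of [M] becomes a conjugate of a diagonal one. *)
pose e (k : 'I_#|T|) : I := enum_val (cast_ord (esym eIT) k).
have e_bij : bijective e.
  exists (fun i => cast_ord eIT (enum_rank i)) => k.
    by rewrite /e enum_valK cast_ordKV.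
  by rewrite /e cast_ordK enum_rankK.
have sum_e f : \sum_i f i = \sum_k f (e k) :> F.
  by rewrite (reindex e) //; apply: onW_bij.
pose A : 'M[F]_#|T| := \matrix_(k, l) P (e k) (enum_val l).
pose B : 'M[F]_#|T| := \matrix_(k, l) Q (enum_val k) (e l).
have AB1 : A *m B = 1%:M.
  apply/matrixP => i j; rewrite !mxE; under eq_bigr do rewrite !mxE.
  rewrite -(big_enum_val (fun x => P (e i) x * Q x (e j))) PQ.
  by rewrite (inj_eq (bij_inj e_bij)).
have [Au Bu] := mulmx1_unit AB1.
have BE : B = invmx A by rewrite -[RHS]mulmx1 -AB1 mulKmx.
set N := (X in char_poly X).
have -> : N = invmx A *m diag_mx (\row_k d (e k)) *m A.
  rewrite -BE -mulmxA; apply/matrixP => k l; rewrite !mxE.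
  rewrite (eigenbasis_expand _ _ ebM) sum_e; apply: eq_bigr => i _.
  by rewrite mul_diag_mx !mxE.
rewrite char_poly_conj // char_poly_trig ?diag_mx_is_trig //.
rewrite [RHS](reindex e); last exact: onW_bij.
by apply: eq_bigr => k _; rewrite !mxE eqxx mulr1n.
Qed.

End Eigenbasis.

(** * Laplacians of complements, unions, complete graphs and products *)

Section LaplacianKernel.

Variable F : fieldType.

(** Indexing by vertices instead of ordinals lets sums over [G + H] and [G * H] split directly; the
    field is left free because both [R] and [R[i]] occur. *)
Definition lap (G : sgraph) (x y : G) : F :=
  (x == y)%:R * (degree x)%:R - (adj x y)%:R.

Lemma degree_sum (G : sgraph) (x : G) : (degree x)%:R = \sum_y (adj x y)%:R :> F.
Proof.
rewrite /degree -sum1_card natr_sum big_mkcond /=.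
by apply: eq_bigr => y _; rewrite inE; case: adj.
Qed.

Lemma sum_lap (G : sgraph) (x : G) : \sum_y lap x y = 0.
Proof.
rewrite sumrB -degree_sum (sum_deltal (fun=> (degree x)%:R : F)) subrr //.
Qed.

Lemma lap_sym (G : sgraph) (x y : G) : lap x y = lap y x.
Proof.
by rewrite /lap eq_sym adj_sym; case: eqP => [->|_] //; rewrite !mul0r.
Qed.

Lemma lap_compl (G : sgraph) (x y : G) :
  @lap (compl G) x y = #|G|%:R * (x == y)%:R - 1 - lap x y.
Proof.
have deg_compl : (@degree (compl G) x)%:R = #|G|%:R - 1 - (degree x)%:R :> F.
  rewrite !degree_sum -sum1_card natr_sum.
  rewrite -[X in _ - X - _](sum_deltal (fun=> 1) x) -!sumrB; apply: eq_bigr => z _.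
  rewrite /= /compl_rel; case: eqVneq => [<-|_] /=; first by rewrite adj_irr /=; ring.
  by case: adj => /=; ring.
rewrite /lap deg_compl /= /compl_rel.
case: eqVneq => [<-|_] /=; first by rewrite adj_irr /=; ring.
by case: adj => /=; ring.
Qed.

Lemma lap_complete p (x y : complete p) : lap x y = p%:R * (x == y)%:R - 1.
Proof.
have deg : (degree x)%:R = p%:R - 1 :> F.
  rewrite degree_sum -[X in X%:R - 1](card_ord p) -sum1_card natr_sum.
  rewrite -[X in _ - X](sum_deltal (fun=> 1) x) -!sumrB; apply: eq_bigr => z _.
  by rewrite /= /complete_rel; case: eqVneq => _ /=; ring.
rewrite /lap deg /= /complete_rel; case: eqVneq => _ /=; ring.
Qed.

Lemma lap_union (G H : sgraph) (u v : disjoint_union G H) :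
  lap u v = match u, v with
            | inl x, inl y => lap x y
            | inr x, inr y => lap x y
            | _, _ => 0
            end.
Proof.
have sum0 (U : finType) : \sum_(z : U) false%:R = 0 :> F by rewrite big1.
rewrite /lap !degree_sum; case: u => x; case: v => y /=;
  rewrite ?mul0r ?subrr // big_sumType /= sum0 ?addr0 ?add0r //;
  by rewrite degree_sum.
Qed.

Lemma lap_cartesian (G H : sgraph) (u v : cartesian G H) :
  lap u v = lap u.1 v.1 * (u.2 == v.2)%:R + (u.1 == v.1)%:R * lap u.2 v.2.
Proof.
(* The two ways of being adjacent in the product exclude each other by irreflexivity, so the
   indicator of the disjunction is the sum of the indicators. *)
have adjE (a b : cartesian G H) : (adj a b)%:R =
    (a.1 == b.1)%:R * (adj a.2 b.2)%:R + (adj a.1 b.1)%:R * (a.2 == b.2)%:R :> F.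
  rewrite /= /cartesian_rel; case: (eqVneq a.1) => [->|_] /=;
    case: (eqVneq a.2) => [->|_] /=; rewrite ?adj_irr ?orbF /=; ring.
have deg : (degree u)%:R = (degree u.1)%:R + (degree u.2)%:R :> F.
  rewrite !degree_sum; under eq_bigr do rewrite adjE.
  rewrite big_split /= addrC; congr (_ + _).
    rewrite -(pair_bigA _ (fun a b => (adj u.1 a)%:R * (u.2 == b)%:R)) /=.
    apply: eq_bigr => a _; rewrite -[RHS](sum_deltal (fun=> (adj u.1 a)%:R) u.2).
    by apply: eq_bigr => b _; rewrite mulrC.
  rewrite -(pair_bigA _ (fun a b => (u.1 == a)%:R * (adj u.2 b)%:R)) /= exchange_big.
  by apply: eq_bigr => b _; rewrite (sum_deltal (fun=> (adj u.2 b)%:R)).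
rewrite /lap adjE deg.
by case: u v {deg} => [a b] [a' b'] /=; rewrite xpair_eqE -mulnb natrM; ring.
Qed.

(** The Laplacian of a disjoint union is block diagonal: eigenvectors of each part are extended by
    zero to the other. *)
Lemma eigenbasis_union (G H : sgraph) (I J : finType) (d : I -> F) (e : J -> F)
    P Q P' Q' :
  eigenbasis (@lap G) d P Q -> eigenbasis (@lap H) e P' Q' ->
  exists S U, eigenbasis (@lap (disjoint_union G H))
    (fun k : I + J => match k with inl i => d i | inr j => e j end) S U.
Proof.
case=> PQ QP PM [PQ' QP' PM'].
exists (fun k u => match k, u with
                   | inl i, inl x => P i x | inr j, inr y => P' j y | _, _ => 0 end).
exists (fun u k => match u, k with
                   | inl x, inl i => Q x i | inr y, inr j => Q' y j | _, _ => 0 end).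
have sum0l (U : finType) (f : U -> F) : \sum_x 0 * f x = 0.
  by rewrite big1 // => x _; rewrite mul0r.
have sum0r (U : finType) (f : U -> F) : \sum_x f x * 0 = 0.
  by rewrite big1 // => x _; rewrite mulr0.
split=> [i j|x y|i y]; last under eq_bigr do rewrite lap_union.
- by case: i j => [i|i] [j|j]; rewrite big_sumType /= ?sum0l ?sum0r ?addr0 ?add0r.
- by case: x y => [x|x] [y|y]; rewrite big_sumType /= ?sum0l ?sum0r ?addr0 ?add0r.
by case: i y => [i|i] [y|y]; rewrite big_sumType /= ?sum0l ?sum0r ?addr0 ?add0r ?mulr0.
Qed.

Lemma eigenbasis_cartesian (G H : sgraph) (I J : finType) (d : I -> F)
    (e : J -> F) P Q P' Q' :
  eigenbasis (@lap G) d P Q -> eigenbasis (@lap H) e P' Q' ->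
  exists S U, eigenbasis (@lap (cartesian G H)) (fun k : I * J => d k.1 + e k.2) S U.
Proof.
case=> PQ QP PM [PQ' QP' PM'].
have tensor (A B : finType) (f f' : A -> F) (g g' : B -> F) :
    \sum_(u : A * B) (f u.1 * g u.2) * (f' u.1 * g' u.2) =
    (\sum_a f a * f' a) * (\sum_b g b * g' b).
  rewrite big_distrlr /= pair_bigA /=; apply: eq_bigr => u _; ring.
exists (fun k u => P k.1 u.1 * P' k.2 u.2), (fun u k => Q u.1 k.1 * Q' u.2 k.2).
split=> [i j|x y|i y].
- apply: etrans (tensor _ _ (P i.1) (Q^~ j.1) (P' i.2) (Q'^~ j.2)) _.
  by rewrite PQ PQ' -natrM mulnb; case: i j => [? ?] [? ?].
- apply: etrans (tensor _ _ (Q x.1) (P^~ y.1) (Q' x.2) (P'^~ y.2)) _.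
  by rewrite QP QP' -natrM mulnb; case: x y => [? ?] [? ?].
under eq_bigr do rewrite lap_cartesian mulrDr.
rewrite big_split mulrDl /=; congr (_ + _).
  apply: etrans (tensor _ _ (P i.1) (@lap G ^~ y.1) (P' i.2) (fun b => (b == y.2)%:R)) _.
  by rewrite PM sum_delta mulrA.
apply: etrans (tensor _ _ (P i.1) (fun a => (a == y.1)%:R) (P' i.2) (@lap H ^~ y.2)) _.
by rewrite PM' sum_delta mulrCA.
Qed.

(** * The all-ones vector and the spectrum of the complement *)

Section KernelVector.

Variables (G : sgraph) (I : finType) (d : I -> F) (P : I -> G -> F) (Q : G -> I -> F).
Hypothesis ebG : eigenbasis (@lap G) d P Q.

(** The all-ones vector is killed by the Laplacian; pairing it with the eigenvector equation of
    [P i] gives the claim. *)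
Lemma eigenvector_sum i : d i * \sum_x P i x = 0.
Proof.
case: ebG => _ _ PM; rewrite mulr_sumr; under eq_bigr do rewrite -PM.
rewrite exchange_big /= big1 // => x _.
by rewrite -mulr_sumr sum_lap mulr0.
Qed.

(** The number [\sum_x Q x i] is the coordinate along [P i] of the all-ones vector. *)
Lemma one_coord_expand y : \sum_i (\sum_x Q x i) * P i y = 1.
Proof.
case: ebG => _ QP _; under eq_bigr do rewrite mulr_suml.
rewrite exchange_big /=; under eq_bigr do rewrite QP.
by under eq_bigr do rewrite -[_%:R]mul1r; rewrite (sum_delta (fun=> 1)).
Qed.

(** By symmetry of the Laplacian the all-ones vector also lies in its left kernel, so its
    coordinates along eigenvectors of nonzero eigenvalue vanish. Nothing like orthogonality of [P]
    is assumed, hence a statement about [Q] beside the one about [P]. *)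
Lemma one_coord i : d i * \sum_x Q x i = 0.
Proof.
case: (ebG) => PQ QP PM.
have h y : \sum_j (d j * \sum_x Q x j) * P j y = 0.
  rewrite -[RHS](sum_lap y).
  under [RHS]eq_bigr do rewrite lap_sym (eigenbasis_expand _ _ ebG).
  rewrite [RHS]exchange_big /=; apply: eq_bigr => j _.
  by rewrite -mulr_suml; ring.
(* Pairing with the column [i] of [Q] extracts a single coordinate from the vanishing expansion
   [h]. *)
have: \sum_y (\sum_j (d j * \sum_x Q x j) * P j y) * Q y i = 0.
  by rewrite big1 // => y _; rewrite h mul0r.
under eq_bigr do rewrite mulr_suml; rewrite exchange_big /=.
under eq_bigr do (under eq_bigr do rewrite -mulrA; rewrite -mulr_sumr PQ).
by rewrite sum_delta.
Qed.

(** Otherwise every coordinate of the all-ones vector would vanish, against its value 1 at the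
    vertex [x]. *)
Lemma eigenbasis_zero (x : G) : exists i, d i = 0.
Proof.
have [/existsP[i /eqP]|/existsPn dn0] := boolP [exists i, d i == 0].
  by exists i.
have := one_coord_expand x; rewrite big1 => [/esym/eqP|i _]; first by rewrite oner_eq0.
have /eqP := one_coord i; rewrite mulf_eq0 (negPf (dn0 i)) => /eqP ->.
by rewrite mul0r.
Qed.

Lemma eigenbasis_compl i0 : (forall i, (d i == 0) = (i == i0)) ->
  eigenbasis (@lap (compl G)) (fun i => if i == i0 then 0 else #|G|%:R - d i) P Q.
Proof.
move=> d0; case: (ebG) => PQ QP PM; split=> // i y.
under eq_bigr do rewrite lap_compl 2!mulrBr mulr1 mulrCA.
rewrite !sumrB -mulr_sumr sum_delta PM.
case: eqVneq => [->|ni]; last first.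
  have /eqP := eigenvector_sum i.
  by rewrite mulf_eq0 d0 (negPf ni) => /eqP ->; rewrite subr0 mulrBl.
have /eqP -> : d i0 == 0 by rewrite d0.
(* Only the coordinate along [P i0] of the all-ones vector survives, so [P i0] is constant and the
   all-ones matrix multiplies it by [#|G|], which cancels the term [#|G|] of the complement. *)
have Pconst x : P i0 x = (\sum_x Q x i0)^-1.
  have := one_coord_expand x; rewrite (bigD1 i0) //=.
  rewrite [X in _ + X = _]big1 ?addr0 => [|j nj].
    move=> h; have: \sum_x Q x i0 != 0.
      by apply/eqP => c0; move/eqP: h; rewrite c0 mul0r eq_sym oner_eq0.
    by move=> c0; apply: (mulfI c0); rewrite h divff.
  have /eqP := one_coord j; rewrite mulf_eq0 d0 (negPf nj) => /eqP ->.
  by rewrite mul0r.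
rewrite !mul0r subr0 Pconst (eq_bigr _ (fun x _ => Pconst x)).
by rewrite sumr_const mulr_natl subrr.
Qed.

End KernelVector.

(** Either the eigenvalue is zero or the entries of [P i] sum to zero; in the latter case the
    all-ones matrix kills [P i] and only [p] times the identity acts. *)
Lemma complete_eigenvalue p (I : finType) (d : I -> F) P Q i :
  eigenbasis (@lap (complete p)) d P Q -> d i = 0 \/ d i = p%:R.
Proof.
move=> eb; have /eqP := eigenvector_sum eb i; case: eb => PQ _ PM.
rewrite mulf_eq0 => /orP[/eqP|/eqP s0]; [by left | right].
have dP y : d i * P i y = p%:R * P i y.
  rewrite -PM; under eq_bigr do rewrite lap_complete mulrBr mulr1 mulrCA.
  by rewrite sumrB -mulr_sumr sum_delta s0 subr0.
have := PQ i i; rewrite eqxx => PQ1.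
(* Since [P i] pairs to 1 with the column [i] of [Q], scalars can be compared through their action
   on [P i]. *)
have scalar c : c = \sum_x c * P i x * Q x i.
  by under eq_bigr do rewrite -mulrA; rewrite -mulr_sumr PQ1 mulr1.
by rewrite [LHS]scalar [RHS]scalar; apply: eq_bigr => y _; rewrite dP.
Qed.

End LaplacianKernel.

(** * Number of edges, trace and sum of the eigenvalues *)

Lemma handshake (G : sgraph) : (\sum_(x : G) degree x = 2 * #|edges G|)%N.
Proof.
have -> : (\sum_(x : G) degree x = \sum_(u : G * G | adj u.1 u.2) 1)%N.
  rewrite -(pair_big_dep predT (@adj G) (fun _ _ => 1%N)) /=.
  by apply: eq_bigr => x _; rewrite sum1dep_card.
pose ends (u : G * G) := [set u.1; u.2].
(* Adjacent ordered pairs are grouped by their set of ends; each edge receives exactly the two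
   orderings of its ends. *)
rewrite (partition_big ends (mem (edges G))) /=; last first.
  case=> x y /= xy; rewrite inE; apply/existsP; exists x.
  by apply/existsP; exists y; rewrite xy eqxx.
rewrite mulnC -sum_nat_const; apply: eq_bigr => e.
rewrite inE => /existsP[x /existsP[y /andP[xy /eqP ->]]].
have nxy : x != y by apply: contraTneq xy => ->; rewrite adj_irr.
(* The number 2 is rewritten into the form in which [cards2] gives the size of a two-element set. *)
rewrite sum1dep_card -[RHS]/(true.+1) -[X in X.+1](_ : (x, y) != (y, x) = true :> nat).
  rewrite -cards2; congr #|pred_of_set _|; apply/setP=> -[a b].
  rewrite !inE /ends /= !xpair_eqE.
  apply/andP/orP => [[ab /eqP/setP eab]|[] /andP[/eqP-> /eqP->]]; last 2 first.
  - by rewrite xy eqxx.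
  - by rewrite adj_sym xy setUC eqxx.
  have nab : a != b by apply: contraTneq ab => ->; rewrite adj_irr.
  have := eab a; have := eab b; rewrite !inE !eqxx orbT /=.
  move=> /esym/orP[/eqP eb|/eqP eb] /esym/orP[/eqP ea|/eqP ea]; subst a b;
    by rewrite ?eqxx in nab *; auto.
by rewrite xpair_eqE negb_and nxy.
Qed.

(** This turns the mean [2M/N] in the energy into a normalized trace, so the edges of the
    constructed graph need not be counted. *)
Lemma edges_trace (F : fieldType) (G : sgraph) :
  (2 * #|edges G|)%:R = \sum_(x : G) lap F x x :> F.
Proof.
rewrite -handshake natr_sum; apply: eq_bigr => x _.
by rewrite /lap eqxx adj_irr mul1r subr0.
Qed.

Lemma sum_eigenvalues (F : fieldType) (G : sgraph) (I : finType) (d : I -> F) P Q :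
  eigenbasis (@lap F G) d P Q -> \sum_i d i = (2 * #|edges G|)%:R.
Proof.
move=> eb; rewrite edges_trace; under [RHS]eq_bigr do rewrite (eigenbasis_expand _ _ eb).
rewrite exchange_big; apply: eq_bigr => i _; case: eb => PQ _ _ /=.
under eq_bigr do rewrite mulrCA (mulrC (Q _ _)).
by rewrite -mulr_sumr PQ eqxx mulr1.
Qed.

(** * Real eigenvalues, complex eigenvectors, and the ordered spectrum *)

Section RealSpectrum.

Local Open Scope complex_scope.
Variables (R : rcfType).

(** The spectral theorem for hermitian matrices is applied over [R[i]]: the eigenvectors are
    complex, but the eigenvalues are real and are kept in [R]. *)
Lemma laplacian_eigenbasis (G : sgraph) : exists (d : 'I_#|G| -> R) P Q,
  eigenbasis (@lap R[i] G) (fun i => (d i)%:C) P Q.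
Proof.
pose A : 'M[R[i]]_#|G| := \matrix_(i, j) lap R[i] (enum_val i) (enum_val j).
have lapE (x y : G) : lap R[i] x y = (lap R x y)%:C.
  by rewrite /lap rmorphB rmorphM /= !rmorph_nat.
have Aherm : A \is hermsymmx.
  apply: realsym_hermsym.
    apply/is_hermitianmxP; rewrite expr0 scale1r map_mx_id //.
    by apply/matrixP => i j; rewrite !mxE lap_sym.
  by apply/mxOverP => i j; rewrite mxE lapE; apply/complex_realP; eexists.
have /orthomx_spectralP := hermitian_normalmx Aherm.
have := mxOverP (hermitian_spectral_diag_real Aherm).
set S := spectralmx A; set D := spectral_diag A => Dreal defA.
have Su : S \in unitmx by exact: spectral_unit.
exists (fun i => complex.Re (D 0 i)), (fun i x => S i (enum_rank x)),
  (fun x i => invmx S (enum_rank x) i).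
split=> [i j|x y|i y].
- have /matrixP/(_ i j) := mulmxV Su; rewrite !mxE => <-.
  rewrite (reindex (@enum_val G predT)) /=; last exact: onW_bij (enum_val_bij _).
  by apply: eq_bigr => k _; rewrite enum_valK.
- have /matrixP/(_ (enum_rank x) (enum_rank y)) := mulVmx Su.
  by rewrite !mxE (inj_eq enum_rank_inj).
have /matrixP/(_ i (enum_rank y)) : S *m A = diag_mx D *m S.
  by rewrite {1}defA !mulmxA mulmxV // mul1mx.
rewrite mul_diag_mx !mxE => h; rewrite RRe_real // -h.
rewrite (reindex (@enum_val G predT)) /=; last exact: onW_bij (enum_val_bij _).
by apply: eq_bigr => k _; rewrite enum_valK !mxE enum_rankK.
Qed.

Variables (G : sgraph) (I : finType) (d : I -> R) (P : I -> G -> R[i]) (Q : G -> I -> R[i]).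
Hypothesis ebG : eigenbasis (@lap R[i] G) (fun i => (d i)%:C) P Q.

(** Both lists are the roots of the same characteristic polynomial, compared in [R[i]] and pulled
    back along the injection of [R]. *)
Lemma laplacian_spectrum_eigenbasis :
  perm_eq (laplacian_spectrum R G) [seq d i | i <- enum I].
Proof.
rewrite perm_sort; apply: prod_XsubC_eq.
have /eqP <- := xchooseP (laplacian_splits R G).
apply/(map_poly_inj (real_complex R)).
rewrite map_char_poly big_map big_enum /= rmorph_prod.
under [RHS]eq_bigr do rewrite rmorphB /= map_polyX map_polyC /=.
rewrite -(eigenbasis_char_poly ebG); congr char_poly.
apply/matrixP => i j; rewrite !mxE /lap rmorphB /= rmorphMn /= !rmorph_nat.
by rewrite (inj_eq enum_val_inj) -mulr_natl.
Qed.

Lemma laplacian_energy_eigenbasis : laplacian_energy R G =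
  \sum_i `|d i - (\sum_(x : G) lap R x x) / #|G|%:R|.
Proof.
rewrite /laplacian_energy (perm_big _ laplacian_spectrum_eigenbasis) big_map big_enum.
by rewrite -edges_trace.
Qed.

(* Since [0] is an eigenvalue, a positive lower bound on the second smallest
   entry makes it simple. *)
Lemma zero_eigenvalue_simple (n : nat) (mu : n.-tuple R) (c : R) :
    (1 < n)%N -> #|G| = n -> laplacian_spectrum R G = mu ->
    0 <= c -> c < mu`_(n - 2) ->
  exists i0, (forall i, (d i == 0) = (i == i0)) /\ forall i, i != i0 -> c < d i.
Proof.
move=> n1 cG muE c0 cmu.
have [x _] : exists x : G, x \in G by apply/card_gt0P; rewrite cG; lia.
have [i0 /complexI di0] := eigenbasis_zero ebG x.
have big_c i : i != i0 -> c < d i.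
  apply: contraNT; rewrite -leNgt => dic.
  have : (#|[pred i | (d i <= c)%R]| <= 1)%N.
    have -> : #|[pred i | (d i <= c)%R]| = count (fun y => y <= c) mu.
      rewrite -muE (permP laplacian_spectrum_eigenbasis) count_map.
      by rewrite -sum1_card -sum1_count big_enum_cond; apply: eq_bigl.
    (* The order is non-increasing, so index [n - 2] holds the second smallest entry: the first
       [n.-1] entries all exceed [c], and one entry remains. *)
    rewrite -(cat_take_drop n.-1 mu) count_cat.
    rewrite (_ : count _ (take _ _) = 0)%N; last first.
      apply/eqP; rewrite -leqn0 leqNgt -has_count; apply/(hasPn).
      move=> y /(nthP 0)[k]; rewrite size_take size_tuple => kn <-.
      have kn1 : (k < n.-1)%N by move: kn; case: ifP; lia.
      rewrite nth_take // -ltNge; apply: lt_le_trans cmu _.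
      have sorted_mu : sorted >=%R mu by rewrite -muE; apply: sort_sorted; exact: ge_total.
      apply: (sorted_leq_nth ge_trans ge_refl) => //; rewrite ?inE ?size_tuple; lia.
    by rewrite add0n (leq_trans (count_size _ _)) // size_drop size_tuple; lia.
  by move/card_le1_eqP => /(_ i i0); rewrite !inE di0 => ->.
exists i0; split=> // i; apply/eqP/eqP => [di|->//].
by apply/eqP; apply: contraT => /big_c; rewrite di ltNge c0.
Qed.

End RealSpectrum.

Lemma eq_eigenbasis (F : fieldType) (T I : finType) (M : T -> T -> F)
    (d d' : I -> F) P Q :
  d =1 d' -> eigenbasis M d P Q -> eigenbasis M d' P Q.
Proof. by move=> dd' [PQ QP PM]; split=> // i y; rewrite -dd'. Qed.

(** * Spectrum and energy of the constructed graph *)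

Section Construction.

Local Open Scope complex_scope.
Variables (R : rcfType) (p : nat).
Hypothesis p_gt0 : (0 < p)%N.
Variables (J : finType) (kappa : J -> R) (P' : J -> complete p -> R[i])
  (Q' : complete p -> J -> R[i]).
Hypothesis ebK : eigenbasis (@lap R[i] (complete p)) (fun j => (kappa j)%:C) P' Q'.

Definition tilde (G : sgraph) : sgraph :=
  cartesian (disjoint_union (compl G) (complete p)) (complete p).

(** The average degree of [tilde G] when [G] has [n] vertices and [m] edges, with the contributions
    [-1] from both factors of the product collected into [-2]. *)
Definition tilde_mean (n m : nat) : R :=
  (n%:R ^+ 2 + p%:R ^+ 2 - (2 * m)%:R) / (p + n)%:R + p%:R - 2.

Lemma tilde_meanE (G : sgraph) :
  (\sum_(u : tilde G) lap R u u) / #|tilde G|%:R = tilde_mean #|G| #|edges G|.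
Proof.
have trK : \sum_(x : complete p) lap R x x = p%:R * (p%:R - 1).
  under eq_bigr do rewrite lap_complete eqxx mulr1.
  by rewrite sumr_const card_ord mulr_natl.
have trC : \sum_(x : compl G) lap R x x = #|G|%:R * (#|G|%:R - 1) - (2 * #|edges G|)%:R.
  under eq_bigr do rewrite lap_compl eqxx mulr1.
  by rewrite sumrB sumr_const (edges_trace R G) mulr_natl.
have trU : \sum_(u : disjoint_union (compl G) (complete p)) lap R u u =
    #|G|%:R * (#|G|%:R - 1) - (2 * #|edges G|)%:R + p%:R * (p%:R - 1).
  under eq_bigr do rewrite lap_union.
  by rewrite big_sumType /= trC trK.
have cardU : #|disjoint_union (compl G) (complete p)| = (#|G| + p)%N.
  by rewrite card_sum card_ord.
(* The Laplacian of a product is a Kronecker sum, so each factor contributes its trace times the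
   order of the other factor. *)
have -> : \sum_(u : tilde G) lap R u u =
    p%:R * (#|G|%:R * (#|G|%:R - 1) - (2 * #|edges G|)%:R + p%:R * (p%:R - 1))
    + (#|G| + p)%:R * (p%:R * (p%:R - 1)).
  under eq_bigr do rewrite lap_cartesian !eqxx mulr1 mul1r.
  rewrite big_split /=; congr (_ + _).
    rewrite -(pair_bigA _ (fun a (_ : complete p) =>
        @lap R (disjoint_union (compl G) (complete p)) a a)) /= -trU mulr_sumr.
    by apply: eq_bigr => a _; rewrite sumr_const card_ord mulr_natl.
  rewrite -(pair_bigA _ (fun (_ : disjoint_union (compl G) (complete p)) b =>
    @lap R (complete p) b b)) /= trK.
  by rewrite sumr_const cardU [RHS]mulr_natl.
have -> : #|tilde G| = ((#|G| + p) * p)%N by rewrite card_prod cardU card_ord.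
rewrite /tilde_mean addnC natrM natrD.
have p0 : p%:R != 0 :> R by rewrite pnatr_eq0; lia.
have s0 : p%:R + #|G|%:R != 0 :> R by rewrite -natrD pnatr_eq0; lia.
by field; rewrite p0 s0.
Qed.

(** The dependence on the spectrum of [G] is isolated in the sum over [i != i0]. The index [i0]
    yields the eigenvalue 0 of the complement, and the last double sum comes from the product of
    [K_p] with itself. *)
Lemma energy_tilde (n m : nat) (G : sgraph) (I : finType) (d : I -> R) P Q i0
    (a := tilde_mean n m) :
  #|G| = n -> #|edges G| = m ->
  eigenbasis (@lap R[i] G) (fun i => (d i)%:C) P Q ->
  (forall i, (d i == 0) = (i == i0)) ->
  laplacian_energy R (tilde G) =
    \sum_j (`|kappa j - a| + \sum_(i | i != i0) `|n%:R - d i + kappa j - a|)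
    + \sum_j' \sum_j `|kappa j' + kappa j - a|.
Proof.
move=> cG eG ebG d0; have d0C i : ((d i)%:C == 0) = (i == i0).
  by rewrite -d0 -(rmorph0 (real_complex R)) (inj_eq (@complexI R)).
have [S [U ebU]] := eigenbasis_union (eigenbasis_compl ebG d0C) ebK.
have [S' [U' ebT]] := eigenbasis_cartesian ebU ebK.
pose e (k : (I + J) * J) : R := kappa k.2 +
  match k.1 with inl i => if i == i0 then 0 else n%:R - d i | inr j => kappa j end.
have {}ebT : eigenbasis (@lap R[i] (tilde G)) (fun k => (e k)%:C) S' U'.
  apply: eq_eigenbasis ebT => -[[i|j] j'] /=; rewrite /e /= rmorphD /= addrC //.
  by case: ifP; rewrite ?rmorph0 // rmorphB /= rmorph_nat cG.
rewrite (laplacian_energy_eigenbasis ebT) tilde_meanE cG eG -/a.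
rewrite -(pair_bigA _ (fun k j => `|e (k, j) - a|)) big_sumType /=; congr (_ + _).
  rewrite exchange_big; apply: eq_bigr => j _; rewrite (bigD1 i0) //=; congr (_ + _).
    by rewrite /e /= eqxx addr0.
  by apply: eq_bigr => i /negPf ni; rewrite /e /= ni [_ + kappa j]addrC.
by apply: eq_bigr => j' _; apply: eq_bigr => j _; rewrite /e /= [kappa j + _]addrC.
Qed.

Lemma sum_abs_tilde (n m : nat) (G : sgraph) (I : finType) (d : I -> R) P Q i0 j
    (a := tilde_mean n m) :
  (1 < n)%N -> (2 * n <= p)%N -> #|G| = n -> #|edges G| = m ->
  eigenbasis (@lap R[i] G) (fun i => (d i)%:C) P Q -> d i0 = 0 ->
  (forall i, i != i0 -> (2 * m)%:R / (p + n)%:R < d i) ->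
  \sum_(i | i != i0) `|n%:R - d i + kappa j - a| =
    if n == 2%N then `|n%:R - (2 * m)%:R + kappa j - a|
    else (n.-1)%:R * (a - n%:R - kappa j) + (2 * m)%:R.
Proof.
move=> n1 pn cG eG ebG di0 d_gt.
have cI : #|I| = n by rewrite (eigenbasis_card ebG).
have sum_d : \sum_(i | i != i0) d i = (2 * m)%:R.
  apply: (@complexI R); rewrite rmorph_nat -eG -(sum_eigenvalues ebG).
  by rewrite [RHS](bigD1 i0) //= di0 add0r rmorph_sum.
have cI1 : #|[pred i | i != i0]| = n.-1 by rewrite -cI (cardC1 i0).
(* The case [n = 2] is separate because the inequality behind [a_ge] fails for [n = 2], [p = 4];
   there a single index remains and its eigenvalue is the whole sum. *)
case: eqP => [n2|/eqP n2].
  have /card1P[i1 i1E] : #|[pred i | i != i0]| == 1%N by rewrite cI1 n2.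
  have only f : \sum_(i | i != i0) f i = f i1 :> R.
    by rewrite (big_pred1 i1) // => i; have := i1E i; rewrite !inE.
  by rewrite only -sum_d only.
have kappa_le : kappa j <= p%:R.
  have [h|h] := complete_eigenvalue j ebK.
    by rewrite (complexI h) ler0n.
  by rewrite -(rmorph_nat (real_complex R)) in h; rewrite (complexI h).
have s_gt0 : 0 < (p + n)%:R :> R by rewrite ltr0n; lia.
(* Clearing the denominator [p + n], this is [2 (n + p) <= p (p - n)]. *)
have a_ge : n%:R + p%:R - (2 * m)%:R / (p + n)%:R <= a.
  rewrite -subr_ge0 /a /tilde_mean.
  (* From [p >= 2n] and [n >= 3]: [p(p - n) >= p^2/2 >= 3p >= 2(n + p)]. *)
  have : (2 * (n + p) + p * n <= p * p)%N by nia.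
  rewrite -(ler_nat R) natrD !natrM natrD -subr_ge0 => h.
  rewrite [X in 0 <= X](_ : _ =
    (p%:R * p%:R - (2 * (n%:R + p%:R) + p%:R * n%:R)) / (p + n)%:R); last first.
    have s0 : p%:R + n%:R != 0 :> R by rewrite -natrD lt0r_neq0.
    by rewrite natrD; field.
  by rewrite divr_ge0 // ltW.
(* By [di], [kappa_le] and [a_ge] every term inside the absolute value is negative, so the sum
   becomes linear in the [d i]. *)
rewrite (eq_bigr (fun i => (a - n%:R - kappa j) + d i)) => [|i /d_gt di]; last first.
  rewrite ler0_norm; lra.
by rewrite big_split /= sum_d sumr_const cI1 mulr_natl.
Qed.

End Construction.

(** * Comparison of the energies of the two constructed graphs *)

Theorem theorem4p5 (R : rcfType) (n m p : nat) (G1 G2 : sgraph)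
    (mu lambda : n.-tuple R)
    (hn : (2 <= n)%N)
    (hG1 : connected G1) (hG2 : connected G2)
    (hn1 : #|G1| = n) (hn2 : #|G2| = n)
    (hm1 : #|edges G1| = m) (hm2 : #|edges G2| = m)
    (hmu : laplacian_spectrum R G1 = mu)
    (hlambda : laplacian_spectrum R G2 = lambda)
    (hp0 : (0 < p)%N) (hp : (2 * n <= p)%N)
    (hmin : (2 * m)%:R / (p + n)%:R < Num.min mu`_(n - 2) lambda`_(n - 2)) :
  laplacian_energy R
    (cartesian (disjoint_union (compl G1) (complete p)) (complete p)) =
  laplacian_energy R
    (cartesian (disjoint_union (compl G2) (complete p)) (complete p)).
Proof.
(* One eigenbasis of [K_p] serves both graphs, so the terms without eigenvalues of [G1] or [G2]
   agree literally. *)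
have [kappa [P' [Q' ebK]]] := laplacian_eigenbasis R (complete p).
have c_ge0 : 0 <= (2 * m)%:R / (p + n)%:R :> R by rewrite divr_ge0.
move: hmin; rewrite lt_min => /andP[hmin1 hmin2].
have [d1 [P1 [Q1 eb1]]] := laplacian_eigenbasis R G1.
have [d2 [P2 [Q2 eb2]]] := laplacian_eigenbasis R G2.
have [i1 [z1 pos1]] := zero_eigenvalue_simple eb1 hn hn1 hmu c_ge0 hmin1.
have [i2 [z2 pos2]] := zero_eigenvalue_simple eb2 hn hn2 hlambda c_ge0 hmin2.
have z1' : d1 i1 = 0 by apply/eqP; rewrite z1.
have z2' : d2 i2 = 0 by apply/eqP; rewrite z2.
rewrite (energy_tilde hp0 ebK hn1 hm1 eb1 z1) (energy_tilde hp0 ebK hn2 hm2 eb2 z2).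
congr (_ + _); apply: eq_bigr => j _; congr (_ + _).
rewrite (sum_abs_tilde hp0 ebK j hn hp hn1 hm1 eb1 z1' pos1).
by rewrite (sum_abs_tilde hp0 ebK j hn hp hn2 hm2 eb2 z2' pos2).
Qed.
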